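(* Let $\mathsf{C}$ be a regular category, let $A$ be an object of $\mathsf{C}$ (with the convention $A^0 = \operatorname{supp}(A)$), let $k \ge 0$, and let $f\colon A^k\to A^k$ be a morphism. Then the wiring diagram $W(f)$ admits a graph map $W(f)\to E^\circ$ if and only if there is a permutation $\sigma\in\Sigma_k$ such that $\sigma\cdot f$ is a semi-direct product, i.e. there exist integers $m,n\ge 0$ with $m+n=k$, an object $E$, and morphisms $g\colon A^m\to A^m$, $h\colon E\times A^n\to A^n$, $p\colon A^m\to E$ with $\sigma\cdot f = g\rtimes_p h$ under the identification $A^k\cong A^m\times A^n$.
   Context: A regular category is a category with finite limits in which every morphism factors as a regular epimorphism followed by a monomorphism, and regular epimorphisms are stable under pullback. The support $\operatorname{supp}(A)$ is the image of $A\to 1$; the convention is $A^0 := \operatorname{supp}(A)$, with the projection $A^1\to A^0$ being the regular epimorphism $A\twoheadrightarrow\operatorname{supp}(A)$ of the image factorization. Semi-direct product: in a category with finite products, given $g\colon X\to X$, $h\colon E\times Y\to Y$, $p\colon X\to E$, the morphism $g\rtimes_p h\colon X\times Y\to X\times Y$ is the composite $X\times Y \to X\times E\times Y\to X\times Y$ of $(\mathrm{proj}_X, p\circ\mathrm{proj}_X,\mathrm{proj}_Y)$ followed by $(g\circ\mathrm{proj}_X, h\circ\mathrm{proj}_{E\times Y})$; in elements, $(x,y)\mapsto(g(x),h(p(x),y))$. A morphism $u\colon A^k\to B$ is independent of input $i$ if it factors through the projection $\mathrm{proj}_{\neq i}\colon A^k\to A^{k-1}$ omitting the $i$-th coordinate;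 otherwise it depends on input $i$. For $f\colon A^k\to A^k$ write $f_j := \mathrm{proj}_j\circ f$. The wiring diagram $W(f)$ is the digraph with vertices $1,\dots,k$ and an edge $i\to j$ iff $f_j$ depends on input $i$. $E^\circ$ is the digraph with vertices $0,1$ and edges $0\to 0$, $0\to 1$, $1\to 1$. A graph map is a function on vertices carrying edges to edges. For $\sigma\in\Sigma_k$ (the permutations of $\{1,\dots,k\}$), $A^\sigma\colon A^k\to A^k$ is the morphism with $\mathrm{proj}_i\circ A^\sigma = \mathrm{proj}_{\sigma(i)}$, and $\sigma\cdot f := A^\sigma\circ f\circ A^{\sigma^{-1}}$. *)

(* Defs.v *)
From mathcomp Require Import all_boot.
From mathcomp Require Export perm.

Set Implicit Arguments.
Unset Strict Implicit.
Unset Printing Implicit Defensive.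

Declare Scope cat_scope.
Delimit Scope cat_scope with cat.

Record category := Category {
  ob :> Type;
  hom : ob -> ob -> Type;
  idm : forall X : ob, hom X X;
  comp : forall X Y Z : ob, hom Y Z -> hom X Y -> hom X Z;
  comp_assoc : forall (X Y Z W : ob) (h : hom Z W) (g : hom Y Z) (f : hom X Y),
    comp h (comp g f) = comp (comp h g) f;
  comp_idl : forall (X Y : ob) (f : hom X Y), comp (idm Y) f = f;
  comp_idr : forall (X Y : ob) (f : hom X Y), comp f (idm X) = f
}.

Arguments hom {c} X Y.
Arguments idm {c} X.
Arguments comp {c X Y Z} g f.

Notation "g ∘ f" := (comp g f)
  (at level 40, left associativity) : cat_scope.
Open Scope cat_scope.

Record functor (J C : category) := Functor {
  fob :> J -> C;
  fmap : forall i j : J, hom i j -> hom (fob i) (fob j);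
  fmap_id : forall i : J, fmap (idm i) = idm (fob i);
  fmap_comp : forall (i j l : J) (v : hom j l) (u : hom i j),
    fmap (v ∘ u) = fmap v ∘ fmap u
}.

Definition finite (T : Type) : Prop :=
  exists (n : nat) (e : 'I_n -> T), bijective e.

Definition finite_category (J : category) : Prop :=
  finite J /\ forall i j : J, finite (hom i j).

Record cone (J C : category) (D : functor J C) := Cone {
  apex : C;
  leg : forall j : J, hom apex (D j);
  leg_nat : forall (i j : J) (u : hom i j), fmap D u ∘ leg i = leg j
}.

Record limit (J C : category) (D : functor J C) := Limit {
  lim_cone :> cone D;
  lim_lift : forall c : cone D, hom (apex c) (apex lim_cone);
  lim_fact : forall (c : cone D) (j : J),
    leg lim_cone j ∘ lim_lift c = leg c j;
  lim_uniq : forall (c : cone D) (u : hom (apex c) (apex lim_cone)),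
    (forall j : J, leg lim_cone j ∘ u = leg c j) -> u = lim_lift c
}.

Record finlim_category := FinlimCategory {
  flcat :> category;
  finlim : forall J : category, finite_category J ->
    forall D : functor J flcat, limit D
}.

Definition mono (C : category) (X Y : C) (m : hom X Y) : Prop :=
  forall (Z : C) (a b : hom Z X), m ∘ a = m ∘ b -> a = b.

Definition is_coequalizer (C : category) (R X Y : C)
    (a b : hom R X) (q : hom X Y) : Prop :=
  q ∘ a = q ∘ b /\
  forall (Z : C) (t : hom X Z), t ∘ a = t ∘ b ->
    exists! u : hom Y Z, u ∘ q = t.

Definition regular_epi (C : category) (X Y : C) (q : hom X Y) : Prop :=
  exists (R : C) (a b : hom R X), is_coequalizer a b q.

Definition is_pullback (C : category) (P X Y Z : C)
    (p1 : hom P X) (p2 : hom P Y) (f : hom X Z) (g : hom Y Z) : Prop :=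
  f ∘ p1 = g ∘ p2 /\
  forall (W : C) (a : hom W X) (b : hom W Y), f ∘ a = g ∘ b ->
    exists! u : hom W P, p1 ∘ u = a /\ p2 ∘ u = b.

Record image_factorization (C : category) (X Y : C) (f : hom X Y) :=
  ImageFactorization {
    im : C;
    im_cover : hom X im;
    im_incl : hom im Y;
    im_cover_regular : regular_epi im_cover;
    im_incl_mono : mono im_incl;
    im_fact : im_incl ∘ im_cover = f
  }.

(* Limits and image factorizations are chosen; both are unique up to a unique
   isomorphism, so the choice is immaterial. *)
Record regular_category := RegularCategory {
  rcat :> finlim_category;
  image : forall (X Y : rcat) (f : hom X Y), image_factorization f;
  regular_epi_stable : forall (P X Y Z : rcat)
    (p1 : hom P X) (p2 : hom P Y) (f : hom X Z) (g : hom Y Z),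
    is_pullback p1 p2 f g -> regular_epi f -> regular_epi p2
}.

Definition discrete (I : Type) : category.
Proof.
refine (@Category I (fun i j => i = j) (@erefl I)
          (fun i j l v u => etrans u v) _ _ _).
- by move=> i j l m h g f; case: m / h; case: l / g.
- by [].
- by move=> i j f; case: j / f.
Defined.

Definition discrete_functor (I : Type) (C : category) (F : I -> C) :
  functor (discrete I) C.
Proof.
refine (@Functor (discrete I) C F
  (fun i j u => match u in _ = j return hom (F i) (F j) with
                | erefl => idm (F i) end) _ _).
- by [].
- by move=> i j l v u; case: l / v; case: j / u; rewrite /= comp_idl.
Defined.

Lemma discrete_finite (I : finType) : finite_category (discrete I).
Proof.
split=> [|i j]; first by exists #|I|, enum_val; exact: enum_val_bij.
rewrite /hom /=; have [eq_ij|neq_ij] := eqVneq i j.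
  exists 1%N, (fun _ => eq_ij); exists (fun _ => ord0) => u.
    by rewrite (ord1 u).
  exact: eq_irrelevance.
have no_ij (u : i = j) : False by rewrite u eqxx in neq_ij.
exists 0%N, (fun u : 'I_0 => match notF (ltn_ord u) with end).
exists (fun u => match no_ij u with end) => u; first by case: u.
by case: (no_ij u).
Qed.

Definition discrete_cone (I : Type) (C : category) (F : I -> C) (X : C)
  (x : forall i : I, hom X (F i)) : cone (discrete_functor F).
Proof.
refine (@Cone (discrete I) C (discrete_functor F) X x _).
by move=> i j u; case: j / u; rewrite /= comp_idl.
Defined.

Definition prod_limit (C : finlim_category) (I : finType) (F : I -> C) :
    limit (discrete_functor F) :=
  finlim (discrete_finite I) (discrete_functor F).

Definition bigprod (C : finlim_category) (I : finType) (F : I -> C) : C :=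
  apex (prod_limit F).

Definition bigproj (C : finlim_category) (I : finType) (F : I -> C) (i : I) :
    hom (bigprod F) (F i) :=
  leg (prod_limit F) i.

Definition bigtuple (C : finlim_category) (I : finType) (F : I -> C) (X : C)
    (x : forall i : I, hom X (F i)) : hom X (bigprod F) :=
  lim_lift (prod_limit F) (discrete_cone x).

Lemma bigprojK (C : finlim_category) (I : finType) (F : I -> C) (X : C)
    (x : forall i : I, hom X (F i)) (i : I) :
  bigproj F i ∘ bigtuple x = x i.
Proof. exact: (lim_fact (prod_limit F) (discrete_cone x) i). Qed.

Lemma bigprod_ext (C : finlim_category) (I : finType) (F : I -> C) (X : C)
    (a b : hom X (bigprod F)) :
  (forall i : I, bigproj F i ∘ a = bigproj F i ∘ b) -> a = b.
Proof.
move=> eq_ab; set c := discrete_cone (fun i : I => bigproj F i ∘ b).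
have -> : a = lim_lift (prod_limit F) c.
  exact: (@lim_uniq _ _ _ (prod_limit F) c).
by apply: esym; apply: (@lim_uniq _ _ _ (prod_limit F) c).
Qed.

Definition terminal (C : finlim_category) : C :=
  bigprod (fun v : void => match v return C with end).

Definition to_terminal (C : finlim_category) (X : C) : hom X (terminal C) :=
  bigtuple (F := fun v : void => match v return C with end)
    (fun v => match v with end).

Lemma terminal_ext (C : finlim_category) (X : C) (a b : hom X (terminal C)) :
  a = b.
Proof. by apply: bigprod_ext => -[]. Qed.

Definition pair_fam (C : category) (X Y : C) (b : bool) : C :=
  if b then X else Y.

Definition prod2 (C : finlim_category) (X Y : C) : C := bigprod (pair_fam X Y).

Notation "X × Y" := (prod2 X Y) (at level 40, left associativity) : cat_scope.

Definition projl (C : finlim_category) (X Y : C) : hom (X × Y) X :=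
  bigproj (pair_fam X Y) true.

Definition projr (C : finlim_category) (X Y : C) : hom (X × Y) Y :=
  bigproj (pair_fam X Y) false.

Arguments projl {C} X Y.
Arguments projr {C} X Y.

Definition pairm (C : finlim_category) (X Y Z : C) (a : hom Z X) (b : hom Z Y) :
    hom Z (X × Y) :=
  bigtuple (F := pair_fam X Y)
    (fun i => match i return hom Z (pair_fam X Y i) with
              | true => a | false => b end).

Lemma pairmK1 (C : finlim_category) (X Y Z : C) (a : hom Z X) (b : hom Z Y) :
  projl X Y ∘ pairm a b = a.
Proof. exact: (bigprojK (F := pair_fam X Y) _ true). Qed.

Lemma pairmK2 (C : finlim_category) (X Y Z : C) (a : hom Z X) (b : hom Z Y) :
  projr X Y ∘ pairm a b = b.
Proof. exact: (bigprojK (F := pair_fam X Y) _ false). Qed.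

Lemma prod2_ext (C : finlim_category) (X Y Z : C) (a b : hom Z (X × Y)) :
  projl X Y ∘ a = projl X Y ∘ b -> projr X Y ∘ a = projr X Y ∘ b -> a = b.
Proof. by move=> eq1 eq2; apply: bigprod_ext => -[]. Qed.

(* (x, y) |-> (g x, h (p x, y)), through X × (E × Y). *)
Definition semidirect (C : finlim_category) (X Y E : C)
    (g : hom X X) (p : hom X E) (h : hom (E × Y) Y) : hom (X × Y) (X × Y) :=
  pairm (g ∘ projl X (E × Y)) (h ∘ projr X (E × Y))
  ∘ pairm (projl X Y) (pairm (p ∘ projl X Y) (projr X Y)).

Definition supp (C : regular_category) (A : C) : C :=
  im (image (to_terminal A)).

Definition supp_cover (C : regular_category) (A : C) : hom A (supp A) :=
  im_cover (image (to_terminal A)).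

Lemma supp_ext (C : regular_category) (A X : C) (a b : hom X (supp A)) : a = b.
Proof.
apply: (im_incl_mono (i := image (to_terminal A))); exact: terminal_ext.
Qed.

(* The k-th power, with the convention that A^0 is the support of A rather
   than the terminal object. *)
Definition pow (C : regular_category) (A : C) (k : nat) : C :=
  match k with
  | 0 => supp A
  | n.+1 => bigprod (fun _ : 'I_n.+1 => A)
  end.

Definition pow_proj (C : regular_category) (A : C) (k : nat) :
    'I_k -> hom (pow A k) A :=
  match k return 'I_k -> hom (pow A k) A with
  | 0 => fun i => match notF (ltn_ord i) with end
  | n.+1 => fun i => bigproj (fun _ : 'I_n.+1 => A) i
  end.

Definition pow_to_supp (C : regular_category) (A : C) (k : nat) :
    hom (pow A k) (supp A) :=
  match k return hom (pow A k) (supp A) with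
  | 0 => idm (supp A)
  | n.+1 => supp_cover A ∘ bigproj (fun _ : 'I_n.+1 => A) ord0
  end.

Arguments pow_to_supp {C} A k.

(* The argument s is only used for k = 0; for k > 0 it is determined by x. *)
Definition pow_tuple (C : regular_category) (A X : C) (k : nat)
    (s : hom X (supp A)) : ('I_k -> hom X A) -> hom X (pow A k) :=
  match k return ('I_k -> hom X A) -> hom X (pow A k) with
  | 0 => fun _ => s
  | n.+1 => fun x => bigtuple (F := fun _ : 'I_n.+1 => A) x
  end.

Lemma pow_tupleK (C : regular_category) (A X : C) (k : nat)
    (s : hom X (supp A)) (x : 'I_k -> hom X A) (i : 'I_k) :
  pow_proj A i ∘ pow_tuple s x = x i.
Proof. by case: k x i => [x []|k x i] //; exact: bigprojK. Qed.

Lemma pow_ext (C : regular_category) (A X : C) (k : nat)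
    (a b : hom X (pow A k)) :
  (forall i : 'I_k, pow_proj A i ∘ a = pow_proj A i ∘ b) -> a = b.
Proof.
case: k a b => [|k] a b eq_ab; first exact: supp_ext.
exact: bigprod_ext.
Qed.

(* A^r : A^k -> A^n, with i-th coordinate the r(i)-th projection. For k = 1,
   n = 0 this is the cover of the support. *)
Definition pow_reindex (C : regular_category) (A : C) (n k : nat)
    (r : 'I_n -> 'I_k) : hom (pow A k) (pow A n) :=
  pow_tuple (pow_to_supp A k) (fun i => pow_proj A (r i)).

Definition pow_omit (C : regular_category) (A : C) (k : nat) (i : 'I_k) :
    hom (pow A k) (pow A k.-1) :=
  pow_reindex A (lift i).

Definition independent (C : regular_category) (A B : C) (k : nat)
    (u : hom (pow A k) B) (i : 'I_k) : Prop :=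
  exists v : hom (pow A k.-1) B, u = v ∘ pow_omit A i.

Definition depends (C : regular_category) (A B : C) (k : nat)
    (u : hom (pow A k) B) (i : 'I_k) : Prop :=
  ~ independent u i.

Record digraph := Digraph {
  vertex : Type;
  edge : vertex -> vertex -> Prop
}.

Record graph_map (G H : digraph) := GraphMap {
  on_vertex :> vertex G -> vertex H;
  on_edge : forall i j : vertex G,
    edge i j -> edge (on_vertex i) (on_vertex j)
}.

Definition wiring (C : regular_category) (A : C) (k : nat)
    (f : hom (pow A k) (pow A k)) : digraph :=
  @Digraph 'I_k (fun i j => depends (pow_proj A j ∘ f) i).

Definition Ecirc : digraph :=
  @Digraph 'I_2
    (fun i j => (nat_of_ord i, nat_of_ord j) \in [:: (0, 0); (0, 1); (1, 1)]).

Definition perm_act (C : regular_category) (A : C) (k : nat) (s : 'S_k)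
    (f : hom (pow A k) (pow A k)) : hom (pow A k) (pow A k) :=
  pow_reindex A s ∘ f ∘ pow_reindex A (s^-1)%g.

(* The identification of A^k with A^m × A^n: the first m coordinates, and the
   last n. *)
Definition pow_split (C : regular_category) (A : C) (m n k : nat)
    (e : m + n = k) : hom (pow A k) (pow A m × pow A n) :=
  pairm (pow_reindex A (fun i : 'I_m => cast_ord e (lshift n i)))
        (pow_reindex A (fun j : 'I_n => cast_ord e (rshift m j))).

Definition is_iso (C : category) (X Y : C) (u : hom X Y) : Prop :=
  exists v : hom Y X, v ∘ u = idm X /\ u ∘ v = idm Y.

Lemma pow_split_iso (C : regular_category) (A : C) (m n k : nat)
    (e : m + n = k) : is_iso (pow_split A e).
Proof.
case: k / e.
pose s : hom (pow A m × pow A n) (supp A) := pow_to_supp A m ∘ projl _ _.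
exists (pow_tuple s (fun i => match split i with
  | inl a => pow_proj A a ∘ projl (pow A m) (pow A n)
  | inr b => pow_proj A b ∘ projr (pow A m) (pow A n) end)); split.
- apply: pow_ext => i; rewrite comp_assoc pow_tupleK comp_idr.
  case: splitP => j def_i; rewrite -comp_assoc ?pairmK1 ?pairmK2 pow_tupleK;
    by congr pow_proj; apply: val_inj.
- apply: prod2_ext; rewrite comp_assoc ?pairmK1 ?pairmK2 comp_idr;
    apply: pow_ext => i; rewrite comp_assoc !pow_tupleK cast_ord_id.
  + have -> : split (lshift n i) = inl i := unsplitK (inl i).
    by [].
  + have -> : split (rshift m i) = inr i := unsplitK (inr i).
    by [].
Qed.

(* Main.v *)
Require Import Defs.
From mathcomp Require Import all_boot perm.
From Stdlib Require Import Classical.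

Set Implicit Arguments.
Unset Strict Implicit.
Unset Printing Implicit Defensive.

(** A graph map [W(f) -> E°] is a splitting of the inputs into two blocks such
    that no [f_j] with [j] in the first block depends on an input of the second.
    Independence of single inputs adds up: two generalized elements of [A^k]
    that agree on the first block can be joined by changing one coordinate of
    the second block at a time, so [f_j] takes the same value on both. When the
    first block is nonempty, the projection [A^k -> A^m] onto it has a section,
    and composing with it yields [g]; when it is empty, [A^0] is subterminal and
    [g] is the identity. *)

Lemma pow_reindex_proj (C : regular_category) (A : C) (n k : nat)
    (r : 'I_n -> 'I_k) (i : 'I_n) :
  pow_proj A i ∘ pow_reindex A r = pow_proj A (r i).
Proof. exact: pow_tupleK. Qed.

Lemma pow_reindex_comp (C : regular_category) (A : C) (l n k : nat)
    (r : 'I_l -> 'I_n) (t : 'I_n -> 'I_k) :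
  pow_reindex A r ∘ pow_reindex A t = pow_reindex A (t \o r).
Proof. by apply: pow_ext => i; rewrite comp_assoc !pow_reindex_proj. Qed.

Lemma pow_reindex_perm (C : regular_category) (A : C) (k : nat) (s : 'S_k) :
  pow_reindex A (s^-1)%g ∘ pow_reindex A s = idm (pow A k).
Proof.
apply: pow_ext => i.
by rewrite comp_assoc !pow_reindex_proj permKV comp_idr.
Qed.

(** An index other than [i] lies in the image of [lift i], so [r] factors through [lift i] and the
    reindexing factors through [pow_omit]. *)
Lemma pow_reindex_omit (C : regular_category) (A : C) (n k : nat)
    (r : 'I_n -> 'I_k) (i : 'I_k) :
  (forall x, r x != i) -> independent (pow_reindex A r) i.
Proof.
move=> r_neq; have r_lift x : {y | r x = lift i y}.
  by case: (unliftP i (r x)) (r_neq x) => [y ->|->]; [exists y | rewrite eqxx].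
exists (pow_reindex A (fun x => sval (r_lift x))).
rewrite pow_reindex_comp; apply: pow_ext => x; rewrite !pow_reindex_proj /=.
by rewrite -(svalP (r_lift x)).
Qed.

Lemma independent_comp (C : regular_category) (A B D : C) (k : nat)
    (v : hom B D) (u : hom (pow A k) B) (i : 'I_k) :
  independent u i -> independent (v ∘ u) i.
Proof. by case=> w ->; exists (v ∘ w); rewrite comp_assoc. Qed.

(** [a] and [b] become equal after [pow_omit A i]. For [k = 1] this omission lands in the support,
    where parallel maps coincide. *)
Lemma independent_eq (C : regular_category) (A B X : C) (k : nat)
    (u : hom (pow A k) B) (i : 'I_k) (a b : hom X (pow A k)) :
    independent u i ->
    (forall j, j != i -> pow_proj A j ∘ a = pow_proj A j ∘ b) ->
  u ∘ a = u ∘ b.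
Proof.
case=> v -> eq_ab; rewrite -!comp_assoc; congr (v ∘ _).
apply: pow_ext => j; rewrite !comp_assoc pow_reindex_proj eq_ab //.
by rewrite eq_sym neq_lift.
Qed.

Lemma independent_all_eq (C : regular_category) (A B X : C) (k : nat)
    (u : hom (pow A k) B) (s : seq 'I_k) (a b : hom X (pow A k)) :
    (forall i, i \in s -> independent u i) ->
    (forall j, j \notin s -> pow_proj A j ∘ a = pow_proj A j ∘ b) ->
  u ∘ a = u ∘ b.
Proof.
elim: s b => [|i s IHs] b ind_u eq_ab.
  by congr (u ∘ _); apply: pow_ext => j; apply: eq_ab.
(* The intermediate element takes coordinate [i] from [a] and the others from [b]: it can differ
   from [a] only on [s], and from [b] only at [i]. *)
pose b' := pow_tuple (pow_to_supp A k ∘ a)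
  (fun j => if j == i then pow_proj A j ∘ a else pow_proj A j ∘ b).
rewrite (IHs b') => [|j s_j|j s'j]; last 2 first.
- by apply: ind_u; rewrite inE s_j orbT.
- rewrite pow_tupleK; have [//|j_neq_i] := eqVneq j i.
  by rewrite eq_ab // inE negb_or j_neq_i.
apply: (independent_eq (i := i)); first by apply: ind_u; rewrite mem_head.
by move=> j /negPf j_neq_i; rewrite pow_tupleK j_neq_i.
Qed.

Lemma perm_initial_segment (k : nat) (P : pred 'I_k) :
  exists s : 'S_k, forall i, P (s i) = (i < #|P|).
Proof.
(* Listing the indices in [P] first and the others after them rearranges ['I_k]; [s] reads off this
   list. *)
pose t := [seq i <- enum 'I_k | P i] ++ [seq i <- enum 'I_k | ~~ P i].
have perm_t : perm_eq t (ord_tuple k) by rewrite val_ord_tuple perm_filterC.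
have size_P : size [seq i <- enum 'I_k | P i] = #|P|.
  by rewrite cardE /enum_mem -enumT /= filter_predT.
have [s def_t] := tuple_permP perm_t; exists s => i.
have <- : nth i t i = s i.
  by rewrite def_t -tnth_nth tnth_mktuple tnth_ord_tuple.
have lt_i_t : i < size t by rewrite (perm_size perm_t) size_tuple.
rewrite nth_cat size_P; case: ltnP => [lt_i|le_i].
  have := mem_nth i (s := [seq j <- enum 'I_k | P j]) (n := i).
  by rewrite size_P mem_filter => /(_ lt_i)/andP[].
have := mem_nth i (s := [seq j <- enum 'I_k | ~~ P j]) (n := i - #|P|).
rewrite mem_filter ltn_subLR // -size_P -size_cat => /(_ lt_i_t)/andP[].
by move/negPf.
Qed.

Lemma semidirectE (C : finlim_category) (X Y E : C)
    (g : hom X X) (p : hom X E) (h : hom (E × Y) Y) :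
  semidirect g p h
    = pairm (g ∘ projl X Y) (h ∘ pairm (p ∘ projl X Y) (projr X Y)).
Proof.
apply: prod2_ext; rewrite comp_assoc ?pairmK1 ?pairmK2 -comp_assoc.
  by rewrite pairmK1.
by rewrite pairmK2.
Qed.

(** With [E := X] and [p] the identity, [h] sees the whole input and can be the second component of
    [F]. Only the first component is constrained. *)
Lemma semidirect_first_block (C : finlim_category) (X Y : C)
    (F : hom (X × Y) (X × Y)) (g : hom X X) :
    projl X Y ∘ F = g ∘ projl X Y ->
  F = semidirect g (idm X) (projr X Y ∘ F).
Proof.
move=> F_g; rewrite semidirectE comp_idl.
have -> : pairm (projl X Y) (projr X Y) = idm (X × Y).
  by apply: prod2_ext; rewrite ?pairmK1 ?pairmK2 comp_idr.
by rewrite comp_idr; apply: prod2_ext; rewrite ?pairmK1 ?pairmK2.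
Qed.

Lemma pow_split_projl (C : regular_category) (A : C) (m n k : nat)
    (e : m + n = k) (i : 'I_m) :
  pow_proj A i ∘ (projl _ _ ∘ pow_split A e)
    = pow_proj A (cast_ord e (lshift n i)).
Proof. by rewrite pairmK1 pow_reindex_proj. Qed.

Lemma perm_act_proj (C : regular_category) (A : C) (k : nat) (s : 'S_k)
    (f : hom (pow A k) (pow A k)) (i : 'I_k) :
  pow_proj A i ∘ perm_act s f
    = pow_proj A (s i) ∘ f ∘ pow_reindex A (s^-1)%g.
Proof. by rewrite !comp_assoc pow_reindex_proj. Qed.

Lemma first_block_factors (C : regular_category) (A : C) (m n : nat)
    (u : hom (pow A m × pow A n) (pow A m)) :
    (forall (j : 'I_m) (X : C) (a b : hom X (pow A m × pow A n)),
      projl _ _ ∘ a = projl _ _ ∘ b ->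
      pow_proj A j ∘ u ∘ a = pow_proj A j ∘ u ∘ b) ->
  exists g : hom (pow A m) (pow A m), u = g ∘ projl _ _.
Proof.
case: m u => [|m] u ind_u; first by exists (idm _); apply: supp_ext.
(* The section fills the second block with copies of coordinate 0 of the first, so no global point
   of [A] is required. *)
pose t := pairm (idm (pow A m.+1)) (pow_reindex A (fun _ : 'I_n => ord0)).
exists (u ∘ t); apply: pow_ext => j.
rewrite -comp_assoc comp_assoc -[LHS]comp_idr; apply: ind_u.
by rewrite comp_idr comp_assoc pairmK1 comp_idl.
Qed.

(** Since coordinate [i] of [perm_act s f] comes from coordinate [s i] of [f], the vertex [j] moves
    to position [s^-1 j]; the blocks are therefore read off through [s^-1]. *)
Lemma perm_act_semidirect (C : regular_category) (A : C) (m n k : nat)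
    (e : m + n = k) (s : 'S_k) (f : hom (pow A k) (pow A k)) :
    (forall i j, s^-1%g j < m -> m <= s^-1%g i ->
      independent (pow_proj A j ∘ f) i) ->
  exists (E : C) (g : hom (pow A m) (pow A m))
    (h : hom (E × pow A n) (pow A n)) (p : hom (pow A m) E),
    pow_split A e ∘ perm_act s f = semidirect g p h ∘ pow_split A e.
Proof.
move=> ind_f; have [w [wK Kw]] := pow_split_iso A e.
pose F := pow_split A e ∘ perm_act s f ∘ w.
have [|g F_g] := first_block_factors (u := projl _ _ ∘ F).
  move=> j X a b eq_ab; rewrite /F !comp_assoc -(comp_assoc _ (projl _ _)).
  rewrite pow_split_projl pow_reindex_proj.
  set u := pow_proj A _ ∘ f; rewrite -!(comp_assoc u).
  apply: (independent_all_eq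
            (s := [seq i <- enum 'I_k | m <= s^-1%g i])) => i.
    rewrite mem_filter => /andP[le_m_i _]; apply: ind_f => //.
    by rewrite permK /=.
  (* An input placed in the first block is a coordinate of [projl], on which [a] and [b] agree. *)
  rewrite mem_filter mem_enum andbT -ltnNge => lt_i_m.
  rewrite !comp_assoc pow_reindex_proj.
  have -> : s^-1%g i = cast_ord e (lshift n (Ordinal lt_i_m)).
    exact: val_inj.
  rewrite -pow_split_projl -!comp_assoc; congr (_ ∘ _).
  by rewrite !(comp_assoc _ w) Kw !comp_idl.
exists (pow A m), g, (projr _ _ ∘ F), (idm _).
by rewrite -(semidirect_first_block F_g) -comp_assoc wK comp_idr.
Qed.

Lemma semidirect_independent (C : regular_category) (A E : C) (m n k : nat)
    (e : m + n = k) (s : 'S_k) (f : hom (pow A k) (pow A k))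
    (g : hom (pow A m) (pow A m)) (h : hom (E × pow A n) (pow A n))
    (p : hom (pow A m) E) (i j : 'I_k) :
    pow_split A e ∘ perm_act s f = semidirect g p h ∘ pow_split A e ->
    s^-1%g j < m -> m <= s^-1%g i ->
  independent (pow_proj A j ∘ f) i.
Proof.
move=> def_f lt_j_m le_m_i; pose j' := Ordinal lt_j_m.
have def_j : s (cast_ord e (lshift n j')) = j.
  by rewrite -[RHS](permKV s); congr (s _); apply: val_inj.
(* Undoing the permutation exhibits this output as a function of the first-block inputs alone, and
   [i] is not among them. *)
have -> : pow_proj A j ∘ f
    = pow_proj A j' ∘ g ∘ pow_reindex A (s \o (cast_ord e \o lshift n)).
  transitivity (pow_proj A j'
      ∘ (projl _ _ ∘ (pow_split A e ∘ perm_act s f)) ∘ pow_reindex A s).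
    rewrite (comp_assoc (projl _ _)) comp_assoc pow_split_projl perm_act_proj.
    by rewrite def_j -[RHS]comp_assoc pow_reindex_perm comp_idr.
  rewrite def_f semidirectE (comp_assoc (projl _ _)) pairmK1 -!comp_assoc.
  by rewrite (comp_assoc (projl _ _)) pairmK1 pow_reindex_comp.
apply/independent_comp/pow_reindex_omit => x.
apply: contraTneq le_m_i => <-.
by rewrite permK -ltnNge /=.
Qed.

Theorem corollary3p19 (C : regular_category) (A : C) (k : nat)
    (f : hom (pow A k) (pow A k)) :
  inhabited (graph_map (wiring f) Ecirc) <->
  (exists s : 'S_k, exists m n : nat, exists e : m + n = k, exists E : C,
   exists (g : hom (pow A m) (pow A m)) (h : hom (E × pow A n) (pow A n))
     (p : hom (pow A m) E),
     pow_split A e ∘ perm_act s f = semidirect g p h ∘ pow_split A e).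
Proof.
split=> [[c]|[s [m [n [e [E [g [h [p def_f]]]]]]]]].
  (* The first block is the fibre of the graph map over 0. *)
  pose P : pred 'I_k := fun i => on_vertex c i == ord0 :> 'I_2.
  have [s sP] := perm_initial_segment P.
  have le_m_k : #|P| <= k by rewrite -[leqRHS]card_ord max_card.
  exists s, #|P|, (k - #|P|), (subnKC le_m_k).
  apply: perm_act_semidirect => i j.
  rewrite (leqNgt #|P|) -!sP !permKV /P => cj ci.
  (* Dependence is a negation, so independence is obtained classically: a dependence would be an
     edge sent to [1 -> 0], which [Ecirc] lacks. *)
  apply: NNPP => /(on_edge c) /=; move/eqP: cj => ->.
  by case: (on_vertex c i) ci => -[|[|]].
(* First-block vertices go to 0 and the others to 1; only an edge from the second block to the first
   could violate the graph map condition. *)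
pose c i : 'I_2 := if s^-1%g i < m then ord0 else ord_max.
split; exists c => i j; rewrite /= /c.
case: (ltnP (s^-1%g i)) => [_ _|le_m_i]; first by case: ifP.
by case: ifP => // lt_j_m []; apply: semidirect_independent def_f _ _.
Qed.
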